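(* Let $E$ and $F$ be Banach lattices such that $E$ or $F$ is order continuous. Then every positive $M$-weakly compact operator $T\colon E\to F$ is $uaw$-Dunford-Pettis.
   Context: A net $(x_\alpha)$ in a Banach lattice $E$ is $uaw$-convergent to $x$ if $|x_\alpha-x|\wedge u\to 0$ weakly for every $u\in E_+$. A bounded operator $T\colon E\to F$ is $uaw$-Dunford-Pettis if every norm bounded $uaw$-null sequence $(x_n)$ in $E$ satisfies $\|Tx_n\|\to 0$, and $M$-weakly compact if $\|Tx_n\|\to0$ for every norm bounded disjoint sequence $(x_n)$ in $E$. *)

(* Defs.v *)
From HB Require Import structures.
From mathcomp Require Import all_boot all_order all_algebra.
From mathcomp Require Import all_classical all_reals all_analysis.
Set Implicit Arguments. Unset Strict Implicit. Unset Printing Implicit Defensive.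
Import Order.TTheory GRing.Theory Num.Theory.
Import numFieldNormedType.Exports.
Local Open Scope classical_set_scope.
Local Open Scope ring_scope.

Record banach_lattice (R : realType) (V : completeNormedModType R) := BanachLattice {
  ble : V -> V -> Prop;
  bsup : V -> V -> V;
  ble_refl : forall x, ble x x;
  ble_anti : forall x y, ble x y -> ble y x -> x = y;
  ble_trans : forall x y z, ble x y -> ble y z -> ble x z;
  ble_add : forall x y z, ble x y -> ble (x + z) (y + z);
  ble_scale : forall (a : R) x y, 0 <= a -> ble x y -> ble (a *: x) (a *: y);
  bsup_ubl : forall x y, ble x (bsup x y);
  bsup_ubr : forall x y, ble y (bsup x y);
  bsup_least : forall x y z, ble x z -> ble y z -> ble (bsup x y) z;
  bnorm_mono : forall x y, ble (bsup x (- x)) (bsup y (- y)) -> `|x| <= `|y|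
}.

Section BL.
Variables (R : realType) (V : completeNormedModType R) (L : banach_lattice V).

Definition binf (x y : V) : V := - bsup L (- x) (- y).
Definition babs (x : V) : V := bsup L x (- x).

Definition weakly_null (x : nat -> V) : Prop :=
  forall f : {linear V -> R^o}, continuous f ->
    (fun n => f (x n)) @ \oo --> (0 : R^o).

Definition uaw_null (x : nat -> V) : Prop :=
  forall u : V, ble L 0 u -> weakly_null (fun n => binf (babs (x n)) u).

Definition norm_bounded (x : nat -> V) : Prop :=
  exists M : R, forall n, `|x n| <= M.

Definition disjoint_seq (x : nat -> V) : Prop :=
  forall n m, n <> m -> binf (babs (x n)) (babs (x m)) = 0.

Definition order_continuous : Prop :=
  forall (I : Type) (r : I -> I -> Prop) (x : I -> V),
    (exists i : I, True) ->
    (forall i, r i i) ->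
    (forall i j k, r i j -> r j k -> r i k) ->
    (forall i j, exists k, r i k /\ r j k) ->
    (forall i j, r i j -> ble L (x j) (x i)) ->
    (forall i, ble L 0 (x i)) ->
    (forall z, (forall i, ble L z (x i)) -> ble L z 0) ->
    forall e : R, 0 < e -> exists i0, forall i, r i0 i -> `|x i| < e.

End BL.

Section Ops.
Variables (R : realType) (E F : completeNormedModType R)
  (LE : banach_lattice E) (LF : banach_lattice F).

Definition positive_op (T : E -> F) : Prop :=
  forall x, ble LE 0 x -> ble LF 0 (T x).

Definition uaw_dunford_pettis (T : E -> F) : Prop :=
  forall x : nat -> E, norm_bounded x -> uaw_null LE x ->
    (fun n => `|T (x n)|) @ \oo --> (0 : R).

Definition M_weakly_compact (T : E -> F) : Prop :=
  forall x : nat -> E, norm_bounded x -> disjoint_seq LE x ->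
    (fun n => `|T (x n)|) @ \oo --> (0 : R).
End Ops.

(* Main.v *)
Require Import Defs.
From HB Require Import structures.
From mathcomp Require Import all_boot all_order all_algebra.
From mathcomp Require Import all_classical all_reals all_analysis.
From mathcomp Require Import ring lra.
Import Order.TTheory GRing.Theory Num.Theory.
Import numFieldNormedType.Exports.
Local Open Scope classical_set_scope.
Local Open Scope ring_scope.

(* If [(x n)] is norm bounded and [T] is M-weakly compact, a disjointification
   argument gives, for each [e > 0], some [u >= 0] with
   [`|T (|x n| - u)^+| < e] for all [n].  As
   [T |x n| = T (|x n| - u)^+ + T (inf |x n| u)], it remains to see that the last
   term tends to 0 in norm.  Both [inf |x n| u] and its image under [T] are
   positive, order bounded and weakly null, and in an order continuous Banach
   lattice such sequences are norm null: this is used in [E] or in [F]. *)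

(** * Hahn-Banach theorem for sublinear functionals on a real vector space *)

Section HahnBanach.
Set Implicit Arguments.
Unset Strict Implicit.
Context {R : realType} {V : lmodType R}.

(** One inequality for [a > 0] suffices for positive homogeneity: the reverse one comes from [a^-1],
    and [q 0 = 0] from [a = 2]. *)
Definition sublinear (q : V -> R) : Prop :=
  (forall x y, q (x + y) <= q x + q y) /\
  (forall (a : R) x, 0 < a -> q (a *: x) <= a * q x).

Lemma sublinearZ q (a : R) x : sublinear q -> 0 < a -> q (a *: x) = a * q x.
Proof.
move=> [_ qZ] a0; apply/eqP; rewrite eq_le qZ//=.
have := qZ a^-1 (a *: x); rewrite invr_gt0 scalerA mulVf ?gt_eqF// scale1r.
by move=> /(_ a0); rewrite ler_pdivlMl.
Qed.

Lemma sublinear0 q : sublinear q -> q 0 = 0.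
Proof.
move=> sq; have := sublinearZ 0 sq (ltr0n _ 2); rewrite scaler0; lra.
Qed.

Lemma sublinear_opp q x : sublinear q -> - q (- x) <= q x.
Proof.
by move=> sq; have := sq.1 x (- x); rewrite subrr (sublinear0 sq); lra.
Qed.

(* A sublinear functional below [q] taking the value [- q x] at [- x]. *)
Definition tilt (q : V -> R) (x y : V) : R :=
  inf [set q (y + t *: x) - t * q x | t in [set t : R | 0 <= t]].

Lemma tilt_le q x y t : sublinear q -> 0 <= t ->
  tilt q x y <= q (y + t *: x) - t * q x.
Proof.
move=> sq t0; apply: ge_inf; last by exists t.
(* The infimum is bounded below: [s * q x = q (s *: x) <= q (y + s *: x) + q (- y)]. *)
exists (- q (- y)) => _ [s /= s0 <-].
have [->|s_neq0] := eqVneq s 0.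
  by rewrite scale0r addr0 mul0r subr0 sublinear_opp.
have := sq.1 (y + s *: x) (- y); rewrite addrAC subrr add0r.
rewrite sublinearZ ?lt_def ?s_neq0//; lra.
Qed.

Lemma le_tilt q x y c : (forall t : R, 0 <= t -> c <= q (y + t *: x) - t * q x) ->
  c <= tilt q x y.
Proof.
move=> h; apply: lb_le_inf => [|_ [t /= t0 <-]]; last exact: h.
by exists (q (y + 0 *: x) - 0 * q x); exists 0 => /=.
Qed.

(** Parameters [s] for [y] and [t] for [z] combine to [s + t] for [y + z], and [t] for [y] becomes
    [a * t] for [a *: y]. *)
Lemma sublinear_tilt q x : sublinear q -> sublinear (tilt q x).
Proof.
move=> sq; split=> [y z|a y a0].
  rewrite -lerBlDr; apply: le_tilt => s s0; rewrite lerBlDr -lerBlDl.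
  apply: le_tilt => t t0.
  have := tilt_le x (y + z) sq (addr_ge0 s0 t0).
  rewrite scalerDl addrACA; have := sq.1 (y + s *: x) (z + t *: x); lra.
rewrite -ler_pdivrMl//; apply: le_tilt => t t0; rewrite ler_pdivrMl//.
apply: (le_trans (tilt_le x (a *: y) sq (mulr_ge0 (ltW a0) t0))).
by rewrite -scalerA -scalerDr (sublinearZ _ sq a0) mulrBr mulrA.
Qed.

Lemma tilt_id q x y : sublinear q -> tilt q x y <= q y.
Proof.
by move=> sq; have := tilt_le x y sq (lexx 0); rewrite scale0r addr0 mul0r subr0.
Qed.

Lemma tilt_opp q x : sublinear q -> tilt q x (- x) <= - q x.
Proof.
move=> sq; have := tilt_le x (- x) sq ler01.
by rewrite scale1r addNr sublinear0// mul1r sub0r.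
Qed.

Lemma minimal_sublinear p : sublinear p ->
  exists q, [/\ sublinear q, forall x, q x <= p x &
    forall r, sublinear r -> (forall x, r x <= q x) -> r = q].
Proof.
move=> sp; pose S := {q : V -> R | sublinear q /\ forall x, q x <= p x}.
(* The order is reversed, so that a maximal element in Zorn's lemma is a minimal functional. *)
pose le (q r : S) := `[< forall x, sval r x <= sval q x >].
have [| | | |[q [sq qp]] qmin] := @Zorn S le.
- by move=> q; apply/asboolP.
- move=> q r s /asboolP qr /asboolP rs; apply/asboolP => x.
  exact: le_trans (rs x) (qr x).
- move=> [q hq] [r hr] /asboolP/= qr /asboolP/= rq.
  by apply: eq_exist; apply/funext => x; apply/eqP; rewrite eq_le qr rq.
- move=> A Atot; have [[q0 Aq0]|A0] := pselect (exists q, A q); last first.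
    by exists (exist _ p (conj sp (fun x => lexx _))) => q Aq; case: A0; exists q.
  pose m x : R := inf [set sval q x | q in A].
  have m_le q x : A q -> m x <= sval q x.
    move=> Aq; apply: ge_inf; last by exists q.
    exists (- p (- x)) => _ [r Ar <-]; case: r Ar => r [sr rp] /= _.
    by apply: le_trans (sublinear_opp x sr); rewrite lerN2.
  have le_m c x : (forall q, A q -> c <= sval q x) -> c <= m x.
    move=> h; apply: lb_le_inf; first by exists (sval q0 x); exists q0.
    by move=> _ [q Aq <-]; exact: h.
  suff hm : sublinear m /\ forall x, m x <= p x.
    by exists (exist _ m hm) => q Aq; apply/asboolP => x /=; exact: m_le.
  split; last by move=> x; apply: le_trans (m_le _ _ Aq0) _; exact: (svalP q0).2.
  split=> [x y|a x a0].
    rewrite -lerBlDr; apply: (le_m) => q Aq; rewrite lerBlDr -lerBlDl.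
    apply: (le_m) => r Ar; rewrite lerBlDr.
    (* In a chain, the smaller of [q] and [r] can serve both arguments, so its subadditivity passes
       to the infimum [m]. *)
    have [/asboolP/(_ x)|/asboolP/(_ y)] := Atot _ _ Aq Ar => h.
      have := m_le _ (x + y) Ar; have := (svalP r).1.1 x y; lra.
    have := m_le _ (x + y) Aq; have := (svalP q).1.1 x y; lra.
  rewrite -ler_pdivrMl//; apply: (le_m) => q Aq; rewrite ler_pdivrMl//.
  apply: le_trans (m_le _ _ Aq) _; exact: (svalP q).1.2.
exists q; split=> // r sr rq.
have rp x : r x <= p x by exact: le_trans (rq x) (qp x).
have := qmin (exist _ r (conj sr rp)); rewrite /le /=.
by move=> /(_ (introT (asboolP _) rq)) [].
Qed.

(* A minimal sublinear functional equals all its tilts, hence is odd. *)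
Lemma hahn_banach p x0 : sublinear p ->
  exists f : {linear V -> R^o}, (forall x, f x <= p x) /\ f x0 = p x0.
Proof.
(* Starting from the tilt at [x0] forces [q (- x0) <= - p x0], hence [q x0 = p x0] once [q] is
   odd. *)
move=> sp; have [q [sq qp qmin]] := minimal_sublinear (sublinear_tilt x0 sp).
have qN x : q (- x) = - q x.
  have := qmin _ (sublinear_tilt x sq) (fun y => tilt_id _ _ sq).
  move=> /(congr1 (fun g => g (- x))) <-.
  apply/eqP; rewrite eq_le tilt_opp//=.
  have := sublinear_opp x (sublinear_tilt x sq).
  have := tilt_id x x sq; lra.
have qD x y : q (x + y) = q x + q y.
  apply/eqP; rewrite eq_le sq.1/=.
  by have := sq.1 (- x) (- y); rewrite -opprD !qN; lra.
have qZ (a : R) x : q (a *: x) = a * q x.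
  have [a0|a0|->] := ltgtP a 0; last by rewrite scale0r mul0r sublinear0.
  - have Na0 : 0 < - a by rewrite oppr_gt0.
    by have := sublinearZ x sq Na0; rewrite scaleNr qN; lra.
  - exact: sublinearZ.
have qlin : linear (q : V -> R^o) by move=> a x y; rewrite qD qZ.
pose m := GRing.isLinear.Build R V R^o *:%R q qlin.
pose f : {linear V -> R^o} := HB.pack q m.
exists f; rewrite /f /=; split=> [x|].
  exact: le_trans (qp x) (tilt_id _ _ sp).
apply/eqP; rewrite eq_le; apply/andP; split.
  exact: le_trans (qp x0) (tilt_id _ _ sp).
by have := le_trans (qp (- x0)) (tilt_opp x0 sp); rewrite qN; lra.
Qed.

End HahnBanach.

(** * Order arithmetic and lattice identities *)

Section BanachLattice.
Set Implicit Arguments.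
Unset Strict Implicit.
Context {R : realType} {V : completeNormedModType R}.
Variable L : banach_lattice V.

Local Notation "x <<= y" := (ble L x y) (at level 70).

Definition bpos (x : V) : V := bsup L x 0.

Lemma ble_subr0 x y : x <<= y <-> 0 <<= y - x.
Proof.
split=> h; first by have := ble_add (- x) h; rewrite subrr.
by have := ble_add x h; rewrite add0r subrK.
Qed.

Lemma ble_opp x y : x <<= y -> - y <<= - x.
Proof. by rewrite ble_subr0 => h; apply/ble_subr0; rewrite opprK addrC. Qed.

Lemma ble_addm x y z t : x <<= y -> z <<= t -> x + z <<= y + t.
Proof.
move=> xy zt; apply: (ble_trans (ble_add z xy)).
by rewrite ![y + _]addrC; exact: ble_add.
Qed.

Lemma ble_addr_ge0 x y : 0 <<= y -> x <<= x + y.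
Proof. by move=> y0; apply/ble_subr0; rewrite addrAC subrr add0r. Qed.

Lemma ble_subl_ge0 x y : 0 <<= y -> x - y <<= x.
Proof. by move=> y0; apply/ble_subr0; rewrite opprB addrC subrK. Qed.

Lemma bscale_ge0 (a : R) x : 0 <= a -> 0 <<= x -> 0 <<= a *: x.
Proof. by move=> a0 /(ble_scale a0); rewrite scaler0. Qed.

Lemma ble_scalel (a b : R) x : a <= b -> 0 <<= x -> a *: x <<= b *: x.
Proof.
move=> ab x0; apply/ble_subr0; rewrite -scalerBl.
by apply: bscale_ge0 => //; rewrite subr_ge0.
Qed.

Lemma bsum_ge0 (I : Type) (r : seq I) (P : pred I) (F : I -> V) :
  (forall i, P i -> 0 <<= F i) -> 0 <<= \sum_(i <- r | P i) F i.
Proof.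
move=> F0; elim/big_ind: _ => [|x y x0 y0|//]; first exact: ble_refl.
by rewrite -[0]addr0; exact: ble_addm.
Qed.

Lemma bsupD x y z : bsup L (x + z) (y + z) = bsup L x y + z.
Proof.
apply: (ble_anti (b := L)).
  by apply: bsup_least; apply: ble_add; [exact: bsup_ubl|exact: bsup_ubr].
rewrite -[X in _ <<= X](subrK z); apply: ble_add; apply: bsup_least.
- by have := ble_add (- z) (bsup_ubl L (x + z) (y + z)); rewrite addrK.
- by have := ble_add (- z) (bsup_ubr L (x + z) (y + z)); rewrite addrK.
Qed.

Lemma binf_lbl x y : binf L x y <<= x.
Proof. by rewrite -[X in _ <<= X]opprK; apply/ble_opp/bsup_ubl. Qed.

Lemma binf_lbr x y : binf L x y <<= y.
Proof. by rewrite -[X in _ <<= X]opprK; apply/ble_opp/bsup_ubr. Qed.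

Lemma binf_greatest x y z : z <<= x -> z <<= y -> z <<= binf L x y.
Proof.
by move=> zx zy; rewrite -[z]opprK; apply/ble_opp/bsup_least; exact: ble_opp.
Qed.

Lemma binf_mono x y z t : x <<= y -> z <<= t -> binf L x z <<= binf L y t.
Proof.
move=> xy zt; apply: binf_greatest.
- exact: ble_trans (binf_lbl _ _) xy.
- exact: ble_trans (binf_lbr _ _) zt.
Qed.

Lemma bpos_ge0 x : 0 <<= bpos x. Proof. exact: bsup_ubr. Qed.

Lemma bpos_ge x : x <<= bpos x. Proof. exact: bsup_ubl. Qed.

Lemma bpos_least x y : x <<= y -> 0 <<= y -> bpos x <<= y.
Proof. exact: bsup_least. Qed.

Lemma bpos_mono x y : x <<= y -> bpos x <<= bpos y.
Proof.
by move=> xy; apply: bpos_least (bpos_ge0 _); exact: ble_trans (bpos_ge _).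
Qed.

Lemma bpos_id x : 0 <<= x -> bpos x = x.
Proof.
move=> x0; apply: (ble_anti (b := L)) (bpos_ge _).
by apply: bpos_least => //; exact: ble_refl.
Qed.

Lemma bpos_eq0 x : bpos x = 0 -> x <<= 0.
Proof. by move=> <-; exact: bpos_ge. Qed.

Lemma bposBid x : bpos x - x = bpos (- x).
Proof.
rewrite /bpos -bsupD subrr add0r; apply: (ble_anti (b := L));
  by apply: bsup_least; [exact: bsup_ubr|exact: bsup_ubl].
Qed.

Lemma sub_binf x u : x - binf L x u = bpos (x - u).
Proof.
rewrite /binf opprK addrC -bsupD addNr addrC; apply: (ble_anti (b := L));
  by apply: bsup_least; [exact: bsup_ubr|exact: bsup_ubl].
Qed.

(** The positive and negative parts of [x] are disjoint: if [w] is their infimum, the positive part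
    minus [w] still dominates [x] and 0, so [w <<= 0]. Positive elements below them inherit this. *)
Lemma binf_bpos_opp x y z : 0 <<= y -> y <<= bpos x -> 0 <<= z ->
  z <<= bpos (- x) -> binf L y z = 0.
Proof.
move=> y0 yx z0 zx; apply: (ble_anti (b := L)); last exact: binf_greatest.
apply: (ble_trans (binf_mono yx zx)); set w := binf L _ _.
suff : bpos x <<= bpos x - w.
  by move=> /(ble_add (- bpos x))/ble_opp; rewrite addrAC subrr add0r opprK oppr0.
apply: bpos_least; last by apply/(ble_subr0 w (bpos x)).1; exact: binf_lbl.
have := binf_lbr (bpos x) (bpos (- x)); rewrite -/w -bposBid.
by move=> /(ble_add (x - w)); rewrite addrC subrK addrA subrK.
Qed.

Lemma binfC x y : binf L x y = binf L y x.
Proof.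
apply: (ble_anti (b := L));
  by apply: binf_greatest; [exact: binf_lbr|exact: binf_lbl].
Qed.

(** * The modulus and the monotonicity of the norm *)

Lemma babs_ge x : x <<= babs L x. Proof. exact: bsup_ubl. Qed.

Lemma babs_geN x : - x <<= babs L x. Proof. exact: bsup_ubr. Qed.

Lemma babs_least x y : x <<= y -> - x <<= y -> babs L x <<= y.
Proof. exact: bsup_least. Qed.

Lemma babs_ge0 x : 0 <<= babs L x.
Proof.
have := ble_addm (babs_ge x) (babs_geN x); rewrite subrr -mulr2n -scaler_nat.
move=> /(@bscale_ge0 2^-1 _ _); rewrite scalerA mulVf// scale1r; apply.
by rewrite invr_ge0.
Qed.

Lemma babs_id x : 0 <<= x -> babs L x = x.
Proof.
move=> x0; apply: (ble_anti (b := L)) (babs_ge _).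
apply: babs_least; first exact: ble_refl.
by apply: (ble_trans _ x0); have := ble_opp x0; rewrite oppr0.
Qed.

Lemma norm_babs x : `|babs L x| = `|x|.
Proof.
have e : bsup L (babs L x) (- babs L x) = bsup L x (- x) by exact/babs_id/babs_ge0.
by apply/eqP; rewrite eq_le; apply/andP; split; apply: (bnorm_mono (b := L));
  rewrite e; exact: ble_refl.
Qed.

Lemma le_norm_pos x y : 0 <<= x -> x <<= y -> `|x| <= `|y|.
Proof.
move=> x0 xy; apply: (bnorm_mono (b := L)).
by rewrite -/(babs L x) -/(babs L y) !babs_id//; exact: ble_trans xy.
Qed.

Lemma le_norm_bpos x y : x <<= y -> `|bpos x| <= `|y|.
Proof.
move=> xy; rewrite -(norm_babs y); apply: le_norm_pos (bpos_ge0 _) _.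
apply: bpos_least (babs_ge0 _); exact: ble_trans (babs_ge _).
Qed.

(** * Archimedean property, closedness of the cone, positive functionals *)

Lemma ble0_norm x : `|bpos x| <= 0 -> x <<= 0.
Proof. by rewrite normr_le0 => /eqP/bpos_eq0. Qed.

Lemma bpos_scale (a : R) x : 0 < a -> bpos (a *: x) <<= a *: bpos x.
Proof.
move=> a0; apply: bpos_least; last exact: bscale_ge0 (ltW a0) (bpos_ge0 _).
exact: ble_scale (ltW a0) (bpos_ge _).
Qed.

Lemma sublinear_norm_bpos : sublinear (fun x => `|bpos x|).
Proof.
split=> [x y|a x a0].
  apply: le_trans (ler_normD _ _); apply: le_norm_bpos.
  by apply: ble_addm; exact: bpos_ge.
rewrite -[X in X * _]gtr0_norm// -normrZ.
apply: le_norm_pos (bpos_ge0 _) (bpos_scale _ a0).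
Qed.

(** Monotonicity of the norm gives [n * |bpos x| <= |y|] in norms for all [n], so the positive part
    of [x] vanishes. *)
Lemma archimedean_ble0 x y : (forall n, n%:R *: x <<= y) -> x <<= 0.
Proof.
move=> h; apply: ble0_norm; rewrite leNgt; apply/negP => x0.
have hn n : n%:R * `|bpos x| <= `|y|.
  case: n => [|n]; first by rewrite mul0r.
  rewrite -[X in X * _]ger0_norm// -normrZ.
  apply: le_trans (le_norm_bpos (h n.+1)).
  apply: le_norm_pos; first exact: bscale_ge0 (bpos_ge0 _).
  have := @bpos_scale n.+1%:R^-1 (n.+1%:R *: x).
  rewrite scalerA mulVf// scale1r invr_gt0 ltr0Sn => /(_ isT).
  by move=> /(ble_scale (ler0n R n.+1)); rewrite scalerA divff// scale1r.
have := hn (Num.truncn (`|y| / `|bpos x|)).+1; rewrite -ler_pdivlMr//.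
by rewrite leNgt truncnS_gt.
Qed.

(** From [a - l <<= u n - l], the positive part of [a - l] has norm at most that of [u n - l], which
    is arbitrarily small. *)
Lemma ble_lim (u : nat -> V) l a :
  u @ \oo --> l -> (\forall n \near \oo, a <<= u n) -> a <<= l.
Proof.
move=> ul au; apply/ble_subr0; rewrite -[l - a]opprK -oppr0; apply: ble_opp.
apply: ble0_norm; apply/ler_addgt0Pl => e e0; rewrite addr0.
move/cvgrPdist_lt : ul => /(_ _ e0) ul.
have [n [aun une]] : exists n, a <<= u n /\ `|l - u n| < e.
  near \oo => n; exists n; split; near: n => //.
apply: (le_trans _ (ltW une)); rewrite distrC; apply: le_norm_bpos.
by rewrite opprB; apply: ble_add.
Unshelve. all: by end_near. Qed.

Lemma lim_ble (u : nat -> V) l b :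
  u @ \oo --> l -> (\forall n \near \oo, u n <<= b) -> l <<= b.
Proof.
move=> ul ub; rewrite -[l]opprK -[b]opprK; apply: ble_opp.
apply: (ble_lim (u := - u)); first exact: cvgN.
by apply: filterS ub => n; exact: ble_opp.
Qed.

(** Hahn-Banach is applied below the norm of the positive part. This bound is at most the norm,
    which gives continuity, and vanishes on negative elements, which gives positivity. *)
Lemma positive_functional x : 0 <<= x ->
  exists f : {linear V -> R^o}, [/\ continuous f,
    forall y, 0 <<= y -> 0 <= f y, forall y, f y <= `|y| & f x = `|x|].
Proof.
move=> x0; have [f [fp fx]] := hahn_banach x sublinear_norm_bpos.
have f_norm y : f y <= `|y|.
  by apply: le_trans (fp y) (le_norm_bpos _); exact: ble_refl.
exists f; split=> //; last by rewrite fx bpos_id.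
- apply: bounded_linear_continuous; apply/linear_boundedP.
  exists 1; split=> // r r1 y; apply: (@le_trans _ _ `|y|); last first.
    by rewrite ler_peMl// ltW.
  by rewrite ler_norml f_norm andbT lerNl -linearN -[leRHS]normrN f_norm.
- move=> y y0; rewrite -oppr_le0 -linearN (le_trans (fp _))//.
  have : bpos (- y) <<= 0.
    by apply: bpos_least (ble_refl _ _); have := ble_opp y0; rewrite oppr0.
  by move=> /(le_norm_pos (bpos_ge0 _)); rewrite normr0.
Qed.

End BanachLattice.

(** * Monotone and weakly null sequences in an order continuous Banach lattice *)

Section OrderContinuous.
Set Implicit Arguments.
Unset Strict Implicit.
Context {R : realType} {V : completeNormedModType R}.
Variable L : banach_lattice V.
Hypothesis Loc : order_continuous L.

Local Notation "x <<= y" := (ble L x y) (at level 70).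

(* The differences [y - t n], with [y] an upper bound of [t], decrease to 0. *)
Lemma order_continuous_cauchy (t : nat -> V) u (e : R) :
  {homo t : n m / (n <= m)%N >-> n <<= m} -> (forall n, t n <<= u) -> 0 < e ->
  exists N, forall n, (N <= n)%N -> `|t n - t N| < e.
Proof.
move=> t_incr tu e0.
(* A supremum of [t] is not yet available, so all upper bounds are used as indices. They are
   directed downwards, since the infimum of two upper bounds is one. *)
pose I := {yn : V * nat | forall n, t n <<= yn.1}.
pose r (i j : I) := ble L (sval j).1 (sval i).1 /\ ((sval i).2 <= (sval j).2)%N.
pose d (i : I) := (sval i).1 - t (sval i).2.
have [| | | | | | |[[y N] yP] hN] := @Loc I r d _ _ _ _ _ _ _ e e0.
- by exists (exist _ (u, 0%N) tu).
- by move=> i; split; [exact: ble_refl|].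
- move=> i j k [ij1 ij2] [jk1 jk2]; split; first exact: ble_trans jk1 ij1.
  exact: leq_trans ij2 jk2.
- move=> [[y n] yP] [[z m] zP].
  have yzP k : t k <<= binf L y z by apply: binf_greatest.
  exists (exist _ (binf L y z, maxn n m) yzP); rewrite /r /=.
  by rewrite leq_maxl leq_maxr; split; split=> //;
    [exact: binf_lbl|exact: binf_lbr].
- move=> i j [ij1 ij2]; apply: ble_addm => //; apply: ble_opp; exact: t_incr.
- by move=> i; apply/(ble_subr0 _ _ _).1; exact: (svalP i).
(* If [z] lies below all differences, then subtracting [z] from an upper bound of [t] leaves an
   upper bound; iterating from [u] gives [n%:R *: z <<= u - t 0]. *)
- move=> z hz; apply: (@archimedean_ble0 _ _ L _ (u - t 0%N)) => n.
  suff h m : n%:R *: z + t m <<= u.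
    by have := ble_add (- t 0%N) (h 0%N); rewrite addrK.
  elim: n m => [|n IHn] m; first by rewrite scale0r add0r.
  have zP k : t k <<= u - n%:R *: z.
    by have := ble_add (- (n%:R *: z)) (IHn k); rewrite addrAC subrr add0r.
  have := hz (exist _ (u - n%:R *: z, m) zP); rewrite /d /=.
  move=> /(ble_add (n%:R *: z + t m)).
  by rewrite -[u - _ - _]addrA -opprD subrK addrA -natr1 scalerDl scale1r
    [z + _]addrC.
- exists N => n Nn; apply: le_lt_trans (hN (exist _ (y, N) yP) _); last first.
    by split; [exact: ble_refl|].
  apply: (le_norm_pos (L := L)); first by apply/(ble_subr0 _ _ _).1; exact: t_incr.
  by apply: ble_add; exact: yP.
Qed.

Lemma order_continuous_cvg (t : nat -> V) u :
  {homo t : n m / (n <= m)%N >-> n <<= m} -> (forall n, t n <<= u) ->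
  exists l : V, t @ \oo --> l.
Proof.
move=> t_incr tu; suff /cauchy_cvg/cvg_ex[l tl] : cauchy (t @ \oo) by exists l.
apply: cauchy_exP => e e0.
have [N hN] := order_continuous_cauchy t_incr tu e0.
exists (t N), N => // n Nn; rewrite -ball_normE /=.
by rewrite distrC; exact: hN.
Qed.

Lemma sum_halves_le n m : \sum_(n <= j < m) 2^-1 ^+ j <= 2 * 2^-1 ^+ n :> R.
Proof.
have [nm|/ltnW mn] := leqP n m; last by rewrite big_geq// mulr_ge0.
suff -> : \sum_(n <= j < m) 2^-1 ^+ j = 2 * 2^-1 ^+ n - 2 * 2^-1 ^+ m :> R.
  by rewrite lerBlDr lerDl mulr_ge0.
rewrite -opprB -!mulrBr -(telescope_sumr _ nm) mulr_sumr -sumrN.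
by apply: eq_bigr => j _; rewrite exprS; field.
Qed.

Lemma halves_lt (e : R) : 0 < e -> \forall k \near \oo, 2^-1 ^+ k < e.
Proof.
move=> e0; have h : `|2^-1 : R| < 1 by rewrite ger0_norm// invf_lt1// ltr1n.
have /cvgrPdist_lt/(_ _ e0) := cvg_expr h.
by apply: filterS => k; rewrite sub0r normrN ger0_norm// exprn_ge0.
Qed.

(* Every norming functional chosen along the way is almost null on the later
   terms, hence on the limits [s n] of [u /\ (z n + ... + z m)] for large [n];
   as the [s n] form a Cauchy sequence, this contradicts [z N <<= s N]. *)
Lemma order_continuous_weakly_null (x : nat -> V) u :
  (forall n, 0 <<= x n) -> (forall n, x n <<= u) -> weakly_null x ->
  (fun n => `|x n|) @ \oo --> (0 : R).
Proof.
move=> x0 xu xw; apply/cvgrPdist_lt => e e0; apply: contrapT => nh.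
have often N : exists n, (N <= n)%N /\ e <= `|x n|.
  apply: contrapT => H; apply: nh; exists N => // n Nn.
  rewrite /= sub0r normrN normr_id ltNge; apply/negP => h.
  by apply: H; exists n.
have /choice[f fP] n := positive_functional (x0 n).
have fc n : continuous (f n) by case: (fP n).
have f_ge0 n y : 0 <<= y -> 0 <= f n y by case: (fP n) => _ + _ _; apply.
have f_norm n y : f n y <= `|y| by case: (fP n).
have fx n : f n (x n) = `|x n| by case: (fP n).
have f_mono n y z : y <<= z -> f n y <= f n z.
  by move=> /(ble_subr0 _ _ _).1 yz; have := f_ge0 n _ yz; rewrite linearB subr_ge0.
have /choice[ev evP] (p : nat * nat) : exists N, forall m, (N <= m)%N ->
    f p.1 (x m) <= 2^-1 ^+ p.2.
  have p0 : 0 < 2^-1 ^+ p.2 :> R by rewrite exprn_gt0// invr_gt0.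
  have /cvgrPdist_lt/(_ _ p0)[N _ hN] := xw (f p.1) (fc p.1).
  exists N => m /hN; rewrite /= sub0r normrN => /ltW; apply: le_trans.
  exact: ler_norm.
have /choice[next nextP] n : exists m, [/\ (n < m)%N, e <= `|x m| &
    forall i, (i <= n)%N -> f i (x m) <= 2^-1 ^+ n].
  (* Only the finitely many functionals [f i] with [i <= n] must be small at [m], so [m] is taken
     beyond all their thresholds. *)
  have [m [mb me]] := often (maxn n.+1 (\max_(i < n.+1) ev (val i, n)))%N.
  exists m; split=> //; first exact: leq_trans (leq_maxl _ _) mb.
  move=> i; rewrite -ltnS => ilt; apply: (evP (i, n)) => /=.
  apply: leq_trans mb; apply: leq_trans (leq_maxr _ _).
  exact: (leq_bigmax (Ordinal ilt)).
have [k0 [_ k0e]] := often 0%N.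
pose k j := iter j next k0; pose z j := x (k j).
have k_lt j : (k j < k j.+1)%N by have [] := nextP (k j).
have k_homo : {homo k : i j / (i <= j)%N}.
  by apply: homo_leq => [|? ? ?|j]; [exact: leqnn|exact: leq_trans|exact: ltnW].
have k_ge j : (j <= k j)%N by elim: j => // j IHj; exact: leq_ltn_trans (k_lt j).
have z_ge j : e <= `|z j| by case: j => // j; have [] := nextP (k j).
have fz i j : (i <= j)%N -> f (k i) (z j.+1) <= 2^-1 ^+ j.
  move=> ij; have [_ _ /(_ _ (k_homo _ _ ij)) h] := nextP (k j).
  apply: le_trans h _; apply: ler_wiXn2l => //.
  by rewrite invf_le1// ler1n.
have z0 j : 0 <<= z j by exact: x0.
(* Truncation by [u] keeps the increasing partial sums order bounded, so they converge in norm. *)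
pose t n m := binf L u (\sum_(n <= j < m) z j).
have t_incr n : {homo t n : m m' / (m <= m')%N >-> m <<= m'}.
  move=> m m' mm'; apply: binf_mono (ble_refl _ _) _.
  have [nm|/ltnW mn] := leqP n m; last by rewrite big_geq//; exact: bsum_ge0.
  by rewrite (big_cat_nat nm mm')/=; apply/ble_addr_ge0/bsum_ge0.
have t_decr n m : t n.+1 m <<= t n m.
  apply: binf_mono (ble_refl _ _) _.
  have [nm|mn] := ltnP n m; last by rewrite !big_geq ?(leqW mn)//; exact: ble_refl.
  by rewrite [X in _ <<= X]big_ltn// addrC; exact: ble_addr_ge0.
have t_ge0 n m : 0 <<= t n m.
  by apply: binf_greatest; [exact: ble_trans (x0 0%N) (xu 0%N)|exact: bsum_ge0].
have /choice[s ts] n : exists l : V, t n @ \oo --> l.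
  by apply: order_continuous_cvg (t_incr n) _ => m; exact: binf_lbl.
have t_le_s n m : t n m <<= s n by apply: (ble_lim (ts n)); exists m => // m' /t_incr.
have s_ge0 n : 0 <<= s n by exact: ble_trans (t_ge0 n 0%N) (t_le_s n 0%N).
have s_decr n : s n.+1 <<= s n.
  by apply: (lim_ble (ts n.+1)); apply: nearW => m; exact: ble_trans (t_le_s n m).
have zs n : z n <<= s n.
  apply: ble_trans (t_le_s n n.+1); rewrite /t big_nat1.
  by apply: binf_greatest; [exact: xu|exact: ble_refl].
(* The tail starts at [n.+1] because [f (k i)] is small only on the terms chosen after [z i];
   continuity carries the bound to the limit. *)
have fs i n : (i <= n)%N -> f (k i) (s n.+1) <= 2 * 2^-1 ^+ n.
  move=> iN; have fts := cvg_comp _ _ (ts n.+1) (fc (k i) (s n.+1)).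
  apply: (cvgr_to_le fts); apply: nearW => m /=.
  apply: le_trans (f_mono _ _ _ (binf_lbr _ _ _)) _.
  rewrite linear_sum big_add1; apply: le_trans (sum_halves_le n m.-1).
  rewrite big_nat [leRHS]big_nat; apply: ler_sum => j /andP[nj _].
  exact/fz/(leq_trans iN).
(* The sequence [s] decreases, so the Cauchy criterion for increasing sequences is applied to its
   opposite. *)
have Ns_incr : {homo (fun n => - s n) : n m / (n <= m)%N >-> n <<= m}.
  apply: homo_leq => [y|y v w|n]; [exact: ble_refl|exact: ble_trans|].
  exact: ble_opp.
have Ns_le0 n : - s n <<= 0 by have := ble_opp (s_ge0 n); rewrite oppr0.
have e2 : 0 < e / 2 by rewrite divr_gt0.
have e4 : 0 < e / 2 / 2 by rewrite divr_gt0.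
have [N hN] := order_continuous_cauchy Ns_incr Ns_le0 e2.
have [n [Nn ne]] : exists n, (N <= n)%N /\ 2^-1 ^+ n < e / 2 / 2.
  have [n0 _ h] := halves_lt e4; exists (maxn N n0).
  by rewrite leq_maxl; split=> //; apply: h; exact: leq_maxr.
(* With [f (k N)] applied to [z N <<= s N = (s N - s n.+1) + s n.+1], one gets
   [e < e / 2 + 2 * (e / 4)], a contradiction. *)
have := hN n.+1 (leqW Nn); rewrite opprK addrC.
have := f_norm (k N) (s N - s n.+1); rewrite linearB.
have := fs N n Nn; have := f_mono (k N) _ _ (zs N); rewrite fx.
have := z_ge N; rewrite -/(z N); lra.
Qed.

End OrderContinuous.

(** * Positive operators and approximation by order bounded parts *)

Section PositiveOperators.
Set Implicit Arguments.
Unset Strict Implicit.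
Context {R : realType} {E F : completeNormedModType R}.
Variables (LE : banach_lattice E) (LF : banach_lattice F) (T : {linear E -> F}).
Hypothesis T_pos : positive_op LE LF T.

Local Notation "x <<= y" := (ble LE x y) (at level 70).

Lemma positive_op_mono x y : x <<= y -> ble LF (T x) (T y).
Proof.
by move=> /(ble_subr0 _ _ _).1/T_pos; rewrite linearB => /(ble_subr0 _ _ _).2.
Qed.

Lemma positive_op_norm_babs x : `|T x| <= `|T (babs LE x)|.
Proof.
rewrite -(norm_babs LF); apply: (le_norm_pos (L := LF)); first exact: babs_ge0.
apply: babs_least; rewrite -?linearN; apply: positive_op_mono.
  exact: babs_ge.
exact: babs_geN.
Qed.

Lemma weakly_null_comp (x : nat -> E) :
  continuous T -> weakly_null x -> weakly_null (T \o x).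
Proof.
move=> Tc xw f fc; pose fT : {linear E -> R^o} := f \o T.
by apply: (xw fT) => y; apply: continuous_comp; [exact: Tc|exact: fc].
Qed.

(* If no [u] works, pick [z k] with [`|T (z k - 4^k (z 0 + ... + z (k-1)))^+| >= e].
   With [zeta = z 0 + z 1 / 2 + z 2 / 4 + ...], subtracting [zeta / 2^k] as well
   makes these positive parts pairwise disjoint, at a cost that tends to 0. *)
Lemma M_weakly_compact_approx (x : nat -> E) (e : R) :
  M_weakly_compact LE T -> norm_bounded x -> (forall n, 0 <<= x n) -> 0 < e ->
  exists u, 0 <<= u /\ forall n, `|T (bpos LE (x n - u))| < e.
Proof.
move=> T_mwc [M xM] x0 e0; apply: contrapT => nh.
have /choice[c cP] u : exists n, 0 <<= u -> e <= `|T (bpos LE (x n - u))|.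
  (* For [u] not positive the index is an arbitrary default. *)
  have [u0|u0] := pselect (0 <<= u); last by exists 0%N.
  apply: contrapT => H; apply: nh; exists u; split=> // n.
  by rewrite ltNge; apply/negP => h; apply: H; exists n.
(* Each new term depends on the sum of the earlier ones, so the recursion runs on the partial sums
   and [z] is read off from them. *)
pose s := fix s k := if k is j.+1 then s j + x (c (4 ^+ j *: s j)) else 0.
pose z j := x (c (4 ^+ j *: s j)).
have z0 j : 0 <<= z j by exact: x0.
have s0 j : 0 <<= s j.
  elim: j => [|j IHj]; first exact: ble_refl.
  exact: ble_trans IHj (ble_addr_ge0 _ (z0 j)).
have z_le_s j k : (j < k)%N -> z j <<= s k.
  elim: k => // k IHk; rewrite ltnS leq_eqVlt => /orP[/eqP->|/IHk jk].
    by rewrite /= addrC; exact: ble_addr_ge0.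
  exact: ble_trans jk (ble_addr_ge0 _ (z0 k)).
pose h i : E := 2^-1 ^+ i *: z i.
have h0 i : 0 <<= h i by apply: bscale_ge0 => //; rewrite exprn_ge0.
have [zeta h_zeta] : exists l : E, series h @ \oo --> l.
  apply/cvg_ex/normed_cvg; apply: (@series_le_cvg _ _ (geometric M 2^-1)).
  - by move=> n /=.
  - by move=> n; rewrite /= mulr_ge0 ?exprn_ge0// (le_trans (normr_ge0 _) (xM 0%N)).
  - by move=> n; rewrite /= normrZ mulrC ger0_norm ?exprn_ge0// ler_wpM2r ?exprn_ge0// xM.
  - by apply: is_cvg_geometric_series; rewrite ger0_norm// invf_lt1// ltr1n.
have h_le i : h i <<= zeta.
  apply: (ble_lim h_zeta); exists i.+1 => // n /= ni.
  by rewrite /series /= (big_rem i) ?mem_index_iota//=; exact/ble_addr_ge0/bsum_ge0.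
have zeta0 : 0 <<= zeta by exact: ble_trans (h0 0%N) (h_le 0%N).
pose a k := z k - 4 ^+ k *: s k.
pose w k := bpos LE (a k).
pose v k := bpos LE (a k - 2^-1 ^+ k *: zeta).
have hz0 k : 0 <<= 2^-1 ^+ k *: zeta by apply: bscale_ge0 => //; rewrite exprn_ge0.
have s40 k : 0 <<= 4 ^+ k *: s k by apply: bscale_ge0 => //; rewrite exprn_ge0.
have v0 k : 0 <<= v k by exact: bpos_ge0.
have a_le k : a k <<= z k by exact: ble_subl_ge0.
have v_disj n m : (n < m)%N -> binf LE (v n) (v m) = 0.
  (* Let [p = 4 ^+ m *: z n - z m]. Since [zeta] dominates [2^-1 ^+ m *: z m] and [n < m], the
     correction in [v n] exceeds [4 ^- m *: z m], so [v n] is below the positive part of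
     [4 ^- m *: p], hence of [p]. Since [z n <<= s m], [v m] is below that of [- p]. *)
  move=> nm; apply: (binf_bpos_opp (x := 4 ^+ m *: z n - z m)) => //.
    apply: bpos_least (bpos_ge0 _ _).
    apply: (@ble_trans _ _ LE _ (4 ^- m *: (4 ^+ m *: z n - z m))).
      rewrite scalerBr scalerA mulVf ?expf_neq0// scale1r.
      apply: ble_addm (a_le _) _; apply: ble_opp.
      apply: ble_trans (ble_scale _ (h_le m)); last by rewrite exprn_ge0.
      rewrite scalerA -exprD; apply: ble_scalel => //.
      have -> : 4 ^- m = 2^-1 ^+ (m + m) :> R.
        by rewrite exprD -exprMn -exprVn -invfM -natrM.
      by apply: ler_wiXn2l; rewrite ?invf_le1 ?ler1n// leq_add2r ltnW.
    apply: ble_trans (ble_scale _ (bpos_ge _ _)) _.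
      by rewrite invr_ge0 exprn_ge0.
    rewrite -[X in _ <<= X]scale1r; apply: ble_scalel (bpos_ge0 _ _).
    by rewrite invf_le1 ?exprn_gt0// exprn_ege1// ler1n.
  apply: bpos_mono; rewrite opprB; apply: ble_trans (ble_subl_ge0 _ _) _ => //.
  apply: ble_addm (ble_refl _ _) _; apply: ble_opp; apply: ble_scale.
    by rewrite exprn_ge0.
  exact: z_le_s.
have v_dseq : disjoint_seq LE v.
  move=> n m /eqP; rewrite !babs_id// neq_ltn => /orP[|mn]; first exact: v_disj.
  by rewrite binfC; exact: v_disj.
have v_bnd : norm_bounded v.
  exists M => n; apply: le_trans (xM (c (4 ^+ n *: s n))).
  apply: (le_norm_bpos (L := LE)); apply: ble_trans (a_le _).
  exact: ble_subl_ge0.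
have Tw k : `|T (w k)| <= `|T (v k)| + 2^-1 ^+ k * `|T zeta|.
  rewrite -[w k](subrK (v k)) linearD addrC; apply: le_trans (ler_normD _ _) _.
  rewrite lerD2l -[X in X * _]ger0_norm ?exprn_ge0// -normrZ -linearZ.
  have v_le_w : v k <<= w k by apply: bpos_mono; exact: ble_subl_ge0.
  apply: (le_norm_pos (L := LF)); first exact/T_pos/(ble_subr0 _ _ _).1.
  apply: positive_op_mono.
  suff : w k <<= v k + 2^-1 ^+ k *: zeta.
    by move=> /(ble_add (- v k)); rewrite addrAC subrr add0r.
  apply: bpos_least.
    have := ble_add (2^-1 ^+ k *: zeta) (bpos_ge LE (a k - 2^-1 ^+ k *: zeta)).
    by rewrite subrK.
  by rewrite -[0]addr0; exact: ble_addm.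
have wb k : e <= `|T (w k)| by exact: cP.
have e2 : 0 < e / 2 by rewrite divr_gt0.
(* Adding 1 keeps the divisor positive even if [T zeta = 0]. *)
have Tz1 : 0 < `|T zeta| + 1 by rewrite ltr_wpDl.
have /cvgrPdist_lt/(_ _ e2) Tv0 := T_mwc v v_bnd v_dseq.
have hk := halves_lt (divr_gt0 e2 Tz1).
have [k [Tvk hTk]] : exists k, `|T (v k)| < e / 2 /\
    2^-1 ^+ k < e / 2 / (`|T zeta| + 1).
  near \oo => k; exists k; split; near: k => //.
  by apply: filterS Tv0 => k; rewrite sub0r normrN normr_id.
have := wb k; have := Tw k; move: hTk; rewrite ltr_pdivlMr// mulrDr mulr1.
have : 0 < 2^-1 ^+ k :> R by rewrite exprn_gt0// invr_gt0.
lra.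
Unshelve. all: by end_near. Qed.

End PositiveOperators.

(** * Combining the approximation with order continuity of [E] or [F] *)

Theorem theorem2p16 (R : realType) (E F : completeNormedModType R)
  (LE : banach_lattice E) (LF : banach_lattice F)
  (T : {linear E -> F}) :
  (order_continuous LE \/ order_continuous LF) ->
  continuous T ->
  positive_op LE LF T ->
  M_weakly_compact LE T ->
  uaw_dunford_pettis LE T.
Proof.
move=> oc Tc T_pos T_mwc x [M xM] xuaw.
pose y n := babs LE (x n).
have y0 n : ble LE 0 (y n) by exact: babs_ge0.
have yb : norm_bounded y by exists M => n; rewrite norm_babs.
have T_inf u : ble LE 0 u -> (fun n => `|T (binf LE (y n) u)|) @ \oo --> (0 : R).
  move=> u0; have yu0 n : ble LE 0 (binf LE (y n) u) by exact: binf_greatest.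
  have yuu n : ble LE (binf LE (y n) u) u by exact: binf_lbr.
  (* Order continuity of [E] gives norm convergence before [T] is applied; that of [F] gives it
     afterwards, with [T u] as order bound. *)
  case: oc => [ocE|ocF].
    have := order_continuous_weakly_null ocE yu0 yuu (xuaw u u0).
    move=> /norm_cvg0P b0; have /cvg_norm := cvg_comp _ _ b0 (Tc 0).
    by rewrite linear0 normr0.
  apply: (order_continuous_weakly_null ocF (u := T u)).
  - by move=> n; exact: T_pos.
  - by move=> n; exact: (positive_op_mono T_pos).
  - exact: weakly_null_comp Tc (xuaw u u0).
apply/cvgrPdist_lt => e e0; have e2 : 0 < e / 2 by rewrite divr_gt0.
have [u [u0 hu]] := M_weakly_compact_approx T_pos T_mwc yb y0 e2.
have /cvgrPdist_lt/(_ _ e2) := T_inf u u0; apply: filterS => n.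
rewrite !sub0r !normrN !normr_id => Tn.
apply: le_lt_trans (positive_op_norm_babs T_pos _) _.
rewrite -/(y n) -[y n](subrK (binf LE (y n) u)) sub_binf linearD.
apply: le_lt_trans (ler_normD _ _) _.
by rewrite [e]splitr; exact: ltrD.
Qed.
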